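(* Let $\mathcal{H}$ be a real Hilbert space, let $F:\mathcal{H}\rightrightarrows\mathcal{H}$ be a set-valued mapping, let $v:\mathcal{H}\to\mathcal{H}$ be a single-valued mapping defined on all of $\mathcal{H}$, and let $\gamma\in(0,+\infty)$. Then the following hold: (i) If the pair $(F,v)$ is monotone, then $T_{\gamma F}^v$ is single-valued (on its domain $\operatorname{ran}(\gamma F+v)$) and firmly nonexpansive. (ii) If the pair $(F,v)$ is $\alpha$-strongly monotone for some $\alpha\in(0,+\infty)$ and $v$ is $L$-Lipschitz continuous with $L\in(0,+\infty)$, then $T_{\gamma F}^v$ is Lipschitz continuous (on its domain) with constant $\frac{1}{1+\alpha\gamma L^{-2}}<1$, and hence $T_{\gamma F}^v$ is a contraction.
   Context: For a set-valued mapping $F:\mathcal{H}\rightrightarrows\mathcal{H}$: $\operatorname{ran}F=\bigcup_{x}F(x)$ and $F^{-1}(y)=\{x: y\in F(x)\}$. Transformed resolvent: $T_{\gamma F}^v=v\circ(\gamma F+v)^{-1}$, i.e. $T_{\gamma F}^v(x)=\{v(z): x\in\gamma F(z)+v(z)\}$; its domain is $\operatorname{ran}(\gamma F+v)$. The pair $(F,v)$ is monotone if $\langle x^*-y^*, v(x)-v(y)\rangle\ge 0$ for all $x,y\in\mathcal{H}$, $x^*\in F(x)$, $y^*\in F(y)$; it is $\alpha$-strongly monotone ($\alpha>0$) if $\langle x^*-y^*, v(x)-v(y)\rangle\ge\alpha\|x-y\|^2$ for all such $x,y,x^*,y^*$. A mapping $T$ that is single-valued on its domain is firmly nonexpansive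 if $\|T(x)-T(y)\|^2\le\langle T(x)-T(y),x-y\rangle$ for all $x,y\in\operatorname{dom}T$ (equivalently, $\|T(x)-T(y)\|^2+\|(\mathrm{Id}-T)(x)-(\mathrm{Id}-T)(y)\|^2\le\|x-y\|^2$). *)

(* Defs.v *)
From HB Require Import structures.
From mathcomp Require Import all_boot all_order all_algebra sesquilinear.
From mathcomp Require Import all_classical all_reals all_analysis.

Set Implicit Arguments.
Unset Strict Implicit.
Unset Printing Implicit Defensive.

Import Order.TTheory GRing.Theory Num.Theory.
Import numFieldNormedType.Exports.

Local Open Scope classical_set_scope.
Local Open Scope ring_scope.

(* A set-valued mapping H => H is a function F : H -> set H. It is single-valued
   on its domain when [is_fun F] (every value has at most one element). *)
Section set_valued_mappings.
Context {R : realType} {H : lmodType R}.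
Implicit Types (F T : H -> set H) (v : H -> H).

Definition sv_dom F : set H := [set x | F x !=set0].

Definition sv_ran F : set H := \bigcup_(x in [set: H]) F x.

Definition sv_inv F : H -> set H := fun y => [set x | F x y].

Definition sv_scale (gamma : R) F : H -> set H :=
  fun x => [set gamma *: u | u in F x].

Definition sv_add F v : H -> set H := fun x => [set u + v x | u in F x].

(* v o (F + v)^-1 *)
Definition tresolvent F v : H -> set H := fun x => v @` sv_inv (sv_add F v) x.

(* The function H -> H selecting the element of T x; it is 0, a junk value,
   outside [sv_dom T]. Meant for T such that [is_fun T]. *)
Definition sv_val T : H -> H := fun_of_rel (fun=> 0) T.

End set_valued_mappings.

(* A real Hilbert space is a complete normed space H over R with an inner
   product [dot : {dot H for idfun}] (a symmetric positive definite bilinear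
   form) that induces its norm. *)
Section hilbert.
Context {R : realType} {H : completeNormedModType R}.
Variable dot : {dot H for idfun}.
Implicit Types (F T : H -> set H) (v : H -> H).

Definition induces_norm := forall x : H, dot x x = `|x| ^+ 2.

Definition monotone_pair F v := forall x y xs ys : H,
  F x xs -> F y ys -> 0 <= dot (xs - ys) (v x - v y).

Definition strongly_monotone_pair (alpha : R) F v := forall x y xs ys : H,
  F x xs -> F y ys -> alpha * `|x - y| ^+ 2 <= dot (xs - ys) (v x - v y).

Definition firmly_nonexpansive T := forall x y : H, sv_dom T x -> sv_dom T y ->
  `|sv_val T x - sv_val T y| ^+ 2 <= dot (sv_val T x - sv_val T y) (x - y).

End hilbert.

(* Main.v *)
Require Import Defs.
From mathcomp Require Import all_boot all_order all_algebra sesquilinear.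
From mathcomp Require Import all_classical all_reals all_analysis.
From mathcomp Require Import lra.
Import Order.TTheory GRing.Theory Num.Theory.
Import numFieldNormedType.Exports.
Local Open Scope classical_set_scope.
Local Open Scope ring_scope.

(** For x = gamma x* + v(a) and y = gamma y* + v(b), put t = v(a), s = v(b).
    Then <t - s, x - y> = gamma <x* - y*, v(a) - v(b)> + |t - s|^2, so a bound
    <x* - y*, v(a) - v(b)> >= c |v(a) - v(b)|^2 makes the resolvent
    (1 + c gamma)-cocoercive, hence 1/(1 + c gamma)-Lipschitz. Monotonicity is
    c = 0; strong monotonicity with v L-Lipschitz gives c = alpha L^-2. *)

Lemma sv_dom_tresolvent (R : realType) (H : lmodType R) (F : H -> set H)
    (v : H -> H) :
  sv_dom (tresolvent F v) = sv_ran (sv_add F v).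
Proof.
apply/seteqP; split=> x /=; first by move=> [_ [z Fzx _]]; exists z.
by move=> [z _ Fzx]; exists (v z); exists z.
Qed.

Section hilbert.
Local Set Implicit Arguments.
Local Unset Strict Implicit.
Context {R : realType} {H : completeNormedModType R}.
Variable dot : {dot H for idfun}.
Hypothesis dot_norm : induces_norm dot.
Implicit Types (F T : H -> set H) (v : H -> H).

Lemma dotC (x y : H) : dot x y = dot y x.
Proof. by rewrite hermC expr0 mul1r. Qed.

(* Expand [0 <= `|M *: u - w| ^+ 2], in place of Cauchy-Schwarz. *)
Lemma ler_norm_of_dot (M : R) (u w : H) : 0 < M ->
  M * `|u| ^+ 2 <= dot u w -> M * `|u| <= `|w|.
Proof.
move=> M0 uw.
have : 0 <= dot (M *: u - w) (M *: u - w) by rewrite dot_norm sqr_ge0.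
rewrite hnormB expr0 mul1r /= !linearZl_LR linearZ/= !dot_norm => h.
rewrite -(ler_pXn2r (n := 2))// ?nnegrE ?mulr_ge0 ?(ltW M0)//.
rewrite exprMn; move: (ler_wpM2l (ltW M0) uw) h; lra.
Qed.

Lemma tresolvent_cocoercive (gamma c : R) F v : 0 < gamma ->
  (forall x y xs ys : H, F x xs -> F y ys ->
    c * `|v x - v y| ^+ 2 <= dot (xs - ys) (v x - v y)) ->
  forall x y t s : H, tresolvent (sv_scale gamma F) v x t ->
    tresolvent (sv_scale gamma F) v y s ->
    (1 + c * gamma) * `|t - s| ^+ 2 <= dot (t - s) (x - y).
Proof.
move=> g0 Fv _ _ _ _ [a [_ [xs Fa <-] <-] <-] [b [_ [ys Fb <-] <-] <-].
(* Regroup [x - y] as [gamma *: (xs - ys) + (v a - v b)]; the hypothesis on [F], multiplied by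
   [gamma], then bounds the first part of the product. *)
rewrite opprD addrACA -scalerBr linearD linearZ/= dot_norm dotC.
have := Fv _ _ _ _ Fa Fb; nra.
Qed.

(** For two values [t], [s] at the same point, cocoercivity gives [M * |t - s| <= |x - x| = 0]. *)
Lemma cocoercive_is_fun (M : R) T : 0 < M ->
  (forall x y t s : H, T x t -> T y s ->
    M * `|t - s| ^+ 2 <= dot (t - s) (x - y)) ->
  is_fun T.
Proof.
move=> M0 TM x t s Tt Ts; apply/subr0_eq/normr0_eq0.
have /(ler_norm_of_dot M0) := TM _ _ _ _ Tt Ts.
rewrite subrr normr0 pmulr_rle0// => h.
by apply/eqP; rewrite eq_le h normr_ge0.
Qed.

(** Squaring the Lipschitz bound gives [L ^- 2 * |v x - v y| ^+ 2 <= |x - y| ^+ 2], which turns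
    strong monotonicity into the hypothesis of [tresolvent_cocoercive]. *)
Lemma strongly_monotone_pair_lipschitz (alpha L : R) F v :
  0 < alpha -> 0 < L -> strongly_monotone_pair dot alpha F v ->
  L.-lipschitz v -> forall x y xs ys : H, F x xs -> F y ys ->
    alpha * L ^- 2 * `|v x - v y| ^+ 2 <= dot (xs - ys) (v x - v y).
Proof.
move=> a0 L0 Fv vL x y xs ys Fx Fy; apply: le_trans (Fv _ _ _ _ Fx Fy).
rewrite -mulrA ler_wpM2l ?(ltW a0)// mulrC ler_pdivrMr ?exprn_gt0// mulrC.
rewrite -exprMn ler_pXn2r ?nnegrE ?mulr_ge0 ?(ltW L0)//.
by have := vL (x, y); apply.
Qed.

End hilbert.

Theorem proposition3p4 (R : realType) (H : completeNormedModType R)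
    (dot : {dot H for idfun}) (dot_norm : induces_norm dot)
    (F : H -> set H) (v : H -> H) (gamma : R) (gamma_gt0 : 0 < gamma) :
  let T := tresolvent (sv_scale gamma F) v in
  (monotone_pair dot F v ->
    [/\ sv_dom T = sv_ran (sv_add (sv_scale gamma F) v),
        is_fun T
      & firmly_nonexpansive dot T]) /\
  (forall alpha L : R, 0 < alpha -> 0 < L ->
    strongly_monotone_pair dot alpha F v -> L.-lipschitz v ->
    let k := 1 / (1 + alpha * gamma * L ^- 2) in
    [/\ is_fun T,
        k.-lipschitz_(sv_dom T) (sv_val T),
        k < 1
      & is_contraction (totalfun_ (sv_dom T) (sv_val T))]).
Proof.
move=> T; split=> [Fv|alpha L a0 L0 Fv vL].
  have TM (x y t s : H) : T x t -> T y s ->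
      1 * `|t - s| ^+ 2 <= dot (t - s) (x - y).
    (* Write [1] as [1 + 0 * gamma] to take [c = 0]. *)
    move=> Tt Ts; rewrite -[1]addr0 -(mul0r gamma).
    apply: (tresolvent_cocoercive dot_norm gamma_gt0 _ Tt Ts) => *.
    by rewrite mul0r; apply: Fv.
  split; [exact: sv_dom_tresolvent|exact: (cocoercive_is_fun dot_norm ltr01 TM)|].
  move=> x y Tx Ty; rewrite -[leLHS]mul1r.
  (* On the domain, [sv_val T] selects a genuine element of [T], not the default [0]. *)
  by apply: TM; apply: fun_of_relP.
have c0 : 0 < alpha * gamma * L ^- 2 by rewrite !mulr_gt0// invr_gt0 exprn_gt0.
set M := 1 + _; move=> k.
have M0 : 0 < M by rewrite addr_gt0.
have TM (x y t s : H) : T x t -> T y s ->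
    M * `|t - s| ^+ 2 <= dot (t - s) (x - y).
  (* Reorder the product to read off [c = alpha * L ^- 2]. *)
  rewrite /M mulrAC; apply: (tresolvent_cocoercive dot_norm gamma_gt0).
  exact: strongly_monotone_pair_lipschitz.
have k1 : k < 1 by rewrite /k ltr_pdivrMr// mul1r ltrDl.
have k0 : 0 <= k by rewrite divr_ge0// ltW.
have Tk : k.-lipschitz_(sv_dom T) (sv_val T).
  move=> [x y] /= [Tx Ty]; rewrite /k mulrAC mul1r ler_pdivlMr// mulrC.
  by apply: (ler_norm_of_dot dot_norm M0); apply: TM; apply: fun_of_relP.
split=> //; first exact: (cocoercive_is_fun dot_norm M0 TM).
(* A contraction constant is a bundled nonnegative number, hence the need for [k0]. *)
by exists (NngNum k0).
Qed.
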